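(* Let $\mathbb{F}$ be a finite field with $q$ elements and let $A, B \in M_2(\mathbb{F}[x])$. Let $\delta$ be the maximum of $\deg(A)$ and $\deg(B)$. If $A$ and $B$ are conjugate, then there is a conjugating matrix $U \in \mathrm{GL}(2,\mathbb{F}[x])$, i.e. $B = UAU^{-1}$, with $$\deg(U) \le (1+q)\,\delta\, q^{7\delta}.$$
   Context: $M_2(\mathbb{F}[x])$ is the ring of $2\times 2$ matrices over the polynomial ring $\mathbb{F}[x]$, and $\mathrm{GL}(2,\mathbb{F}[x])$ is the group of invertible $2\times 2$ matrices over $\mathbb{F}[x]$. Two matrices $A,B\in M_2(\mathbb{F}[x])$ are called conjugate if there is $U\in \mathrm{GL}(2,\mathbb{F}[x])$ with $B=UAU^{-1}$. For a matrix $A \in M_2(\mathbb{F}[x])$, $\deg(A)$ denotes the maximal degree of its entries. In the degenerate case $A=B=0$, $\delta$ is read as $0$. *)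

(* Defs.v *)
From mathcomp Require Import all_boot all_order all_algebra.

Set Implicit Arguments.
Unset Strict Implicit.
Unset Printing Implicit Defensive.

Import GRing.Theory.
Local Open Scope ring_scope.

(* The zero polynomial contributes 0 here instead of -oo; this only affects the
   zero matrix, which gets degree 0. *)
Definition mxdeg (F : fieldType) (A : 'M[{poly F}]_2) : nat :=
  \max_(i < 2) \max_(j < 2) (size (A i j)).-1.

Definition conj_by (F : fieldType) (U A B : 'M[{poly F}]_2) : Prop :=
  U \in unitmx /\ B = U *m A *m invmx U.

Definition conjugate (F : fieldType) (A B : 'M[{poly F}]_2) : Prop :=
  exists U : 'M[{poly F}]_2, conj_by U A B.

(* Main.v *)
Require Import Defs.
From mathcomp Require Import all_boot all_order all_algebra.
From mathcomp Require Import perm ring zify.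

Set Implicit Arguments.
Unset Strict Implicit.
Unset Printing Implicit Defensive.

Import GRing.Theory.
Local Open Scope ring_scope.

(** Let d be the larger of the two degrees, and consider the finite graph whose
vertices are the 2 x 2 matrices of degree at most d, with an edge from X to Y
when Y = E X E^-1 for some invertible E of degree at most d.  It suffices to
show that conjugate A and B of degree at most d are joined by a path in this
graph: a path without repeated vertices has at most q ^ (4 (d + 1)) edges, one
per matrix, and the product of their labels has degree at most
d q ^ (4 (d + 1)), which is below the bound of the theorem for d > 0 because
4 (d + 1) <= 7 d + 1, and equals it, being 0, for d = 0
([linked_bounded]).

The path comes from the Euclidean algorithm on the first column (w, v) of a
conjugating matrix U.  One division w = p v + s writes U = E_p U' where E_p has
rows (p, 1) and (1, 0), and U' has first column (v, s); it replaces B by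
C = E_p^-1 B E_p.  Two facts make this a walk in the graph.

- C still has degree at most d ([euclid_step_mxdeg]).  Geometrically, the
  degree of the conjugates of A is a convex function on the tree of
  GL_2 over F((1/x)).  The intermediate conjugates sit at vertices of the
  geodesic whose ends correspond to A and B; the value is at most d at the ends,
  so it is at most d in between.  Here convexity takes the concrete form of
  [form_deg_le]: up to a unit, the entries of a conjugate of A are values of
  the bilinear form det (x A, y) on the rows of the conjugating matrix, and the
  rows of U' are combinations, with small coefficients, of the top row of U and
  of (0, 1).

- B and C are adjacent ([euclid_step_linked]).  If p has degree at most d then
  E_p is an edge.  Otherwise comparing degrees in B E_p = E_p C forces the
  (0, 1) entry of C to vanish and its diagonal to be scalar; then C commutes
  with unipotent lower triangular matrices, so that B is the conjugate of C by
  the exchange of coordinates E_0, whatever p is.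

When v = 0 the remaining conjugating matrix is constant, hence an edge. *)

(** * Matrices given by their four entries *)

Section Matrix2.

Variable R : comNzRingType.

Definition mx2 (a b c d : R) : 'M[R]_2 :=
  \matrix_(i < 2, j < 2) if i == 0 then (if j == 0 then a else b)
                         else (if j == 0 then c else d).

Lemma mx2_eta (M : 'M[R]_2) : M = mx2 (M 0 0) (M 0 1) (M 1 0) (M 1 1).
Proof.
have ord2 (i : 'I_2) : i != 0 -> i = 1 by case: i => [[|[]]] // *; apply: val_inj.
by apply/matrixP=> i j; rewrite mxE; case: eqVneq => [->|/ord2->];
  case: eqVneq => [->|/ord2->].
Qed.

Lemma forall_mx2 (P : R -> Prop) a b c d :
  (forall i j, P (mx2 a b c d i j)) <-> [/\ P a, P b, P c & P d].
Proof.
split=> [Pabcd|[Pa Pb Pc Pd] i j]; last by rewrite mxE; do 2!case: eqP.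
by split; [have := Pabcd 0 0|have := Pabcd 0 1|have := Pabcd 1 0|have := Pabcd 1 1];
  rewrite mxE.
Qed.

Lemma mx2_inj a b c d a' b' c' d' :
  mx2 a b c d = mx2 a' b' c' d' -> [/\ a = a', b = b', c = c' & d = d'].
Proof.
move/matrixP=> eqM.
by split; [have := eqM 0 0|have := eqM 0 1|have := eqM 1 0|have := eqM 1 1];
  rewrite !mxE.
Qed.

Lemma mul_mx2 a b c d a' b' c' d' :
  mx2 a b c d *m mx2 a' b' c' d' =
  mx2 (a * a' + b * c') (a * b' + b * d') (c * a' + d * c') (c * b' + d * d').
Proof.
apply/matrixP=> i j; rewrite !mxE !big_ord_recl big_ord0 addr0 !mxE /=.
by case: (i == 0); case: (j == 0).
Qed.

Lemma det_mx2 a b c d : \det (mx2 a b c d) = a * d - b * c.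
Proof.
rewrite (expand_det_row _ 0) !big_ord_recl big_ord0 addr0 /cofactor !det_mx11.
by rewrite !mxE /= expr0 expr1; ring.
Qed.

(** [mx2 p 1 1 0] is the elementary matrix of a division with quotient p, and
[mx2 0 1 1 (- p)] is its inverse. *)
Lemma quotient_mx2K p : mx2 p 1 1 0 *m mx2 0 1 1 (- p) = 1%:M.
Proof. by rewrite [RHS]mx2_eta mul_mx2 !mxE /=; congr mx2; ring. Qed.

Lemma euclid_step_intertwine (A B : 'M[R]_2) p u1 u2 v1 v2 :
  B *m mx2 u1 u2 v1 v2 = mx2 u1 u2 v1 v2 *m A ->
  mx2 0 1 1 (- p) *m B *m mx2 p 1 1 0 *m mx2 v1 v2 (u1 - p * v1) (u2 - p * v2)
    = mx2 v1 v2 (u1 - p * v1) (u2 - p * v2) *m A.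
Proof.
have -> : mx2 v1 v2 (u1 - p * v1) (u2 - p * v2)
    = mx2 0 1 1 (- p) *m mx2 u1 u2 v1 v2.
  by rewrite mul_mx2; congr mx2; ring.
move=> eqBU; rewrite -[RHS]mulmxA -eqBU.
by rewrite mulmxA -(mulmxA _ (mx2 p 1 1 0)) quotient_mx2K mulmx1 mulmxA.
Qed.

End Matrix2.

(** * Degree bounds *)

Section Degree.

Variable F : fieldType.
Implicit Types (p q : {poly F}) (m n : nat) (A B U : 'M[{poly F}]_2).

Definition deg_le n p := (size p <= n.+1)%N.

Lemma deg_leW m n p : (m <= n)%N -> deg_le m p -> deg_le n p.
Proof. by rewrite /deg_le => ? ?; lia. Qed.

Lemma deg_leD n p q : deg_le n p -> deg_le n q -> deg_le n (p + q).
Proof.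
by rewrite /deg_le => ? ?; rewrite (leq_trans (size_polyD _ _)) // geq_max;
  apply/andP.
Qed.

Lemma deg_leN n p : deg_le n (- p) = deg_le n p.
Proof. by rewrite /deg_le size_polyN. Qed.

Lemma deg_leB n p q : deg_le n p -> deg_le n q -> deg_le n (p - q).
Proof. by move=> p_n q_n; rewrite deg_leD ?deg_leN. Qed.

Lemma deg_leM m n p q : deg_le m p -> deg_le n q -> deg_le (m + n) (p * q).
Proof.
rewrite /deg_le => p_m q_n; apply: leq_trans (size_polyMleq p q) _.
by rewrite -subn1 leq_subLR add1n -addSn -addnS leq_add.
Qed.

Lemma deg_le_mulI m n p q :
  size p = m.+1 -> deg_le (m + n) (p * q) -> deg_le n q.
Proof.
move=> szp; have p0 : p != 0 by rewrite -size_poly_eq0 szp.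
have [->|q0] := eqVneq q 0; first by rewrite /deg_le size_poly0.
by rewrite /deg_le size_mul // szp addSn /= -addnS leq_add2l.
Qed.

(** This is how a quotient p of large degree trivializes a Euclidean step: its
product with a nonzero polynomial cannot be small. *)
Lemma deg_le_mul0 n p q : (n.+1 < size p)%N -> deg_le n (p * q) -> q = 0.
Proof.
move=> n_p; have p0 : p != 0 by rewrite -size_poly_gt0 (leq_trans _ n_p).
apply: contraTeq; rewrite -size_poly_gt0 => q_gt0.
rewrite /deg_le -ltnNge size_mul // -?size_poly_gt0 //.
by case: (size q) q_gt0 => // m _; rewrite addnS (leq_trans n_p) ?leq_addr.
Qed.

(** The Euclidean induction needs a first column that dominates the second one;
in the row that becomes the top row this follows from the determinant, since
p1 q2 and p2 q1 differ by a constant. *)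
Lemma size_unimodular_row2 p1 p2 q1 q2 :
    size (p1 * q2 - p2 * q1) = 1%N -> (size p2 <= size p1)%N ->
    p1 != 0 -> q1 != 0 ->
  (size q2 <= size q1)%N.
Proof.
move=> szD p21; have [->|q20] := eqVneq q2 0; first by rewrite size_poly0.
rewrite -!size_poly_gt0 => p1_gt0 q1_gt0.
have : (size (p1 * q2)%R <= (size p1 + size q1).-1)%N.
  have -> : p1 * q2 = p1 * q2 - p2 * q1 + p2 * q1 by ring.
  apply: leq_trans (size_polyD _ _) _; rewrite szD geq_max.
  by rewrite (leq_trans (size_polyMleq _ _)) ?andbT; lia.
rewrite size_mul -?size_poly_gt0 //; last by rewrite size_poly_gt0.
by case: (size p1) p1_gt0 => // m _; rewrite !addSn leq_add2l.
Qed.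

Lemma mxdeg_leP n A : reflect (forall i j, deg_le n (A i j)) (mxdeg A <= n)%N.
Proof.
rewrite /mxdeg /deg_le; apply: (iffP (bigmax_leqP _ _ _)) => A_n i.
  by move=> j; have /bigmax_leqP/(_ j isT) := A_n i isT; case: size.
by move=> _; apply/bigmax_leqP=> j _; have := A_n i j; case: size.
Qed.

Lemma mxdeg_mx2P n a b c d :
  (mxdeg (mx2 a b c d) <= n)%N <->
  [/\ deg_le n a, deg_le n b, deg_le n c & deg_le n d].
Proof. by rewrite -(forall_mx2 (deg_le n)); split=> /mxdeg_leP. Qed.

Lemma mxdeg_mul A B : (mxdeg (A *m B) <= mxdeg A + mxdeg B)%N.
Proof.
apply/mxdeg_leP=> i j; rewrite !mxE !big_ord_recl big_ord0 addr0.
by apply: deg_leD; apply: deg_leM; apply/mxdeg_leP.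
Qed.

Lemma mxdeg_tperm n i j : (mxdeg (tperm_mx i j : 'M[{poly F}]_2) <= n)%N.
Proof.
apply/mxdeg_leP=> k l; rewrite !mxE /deg_le.
by case: eqP => _; rewrite ?size_poly1 ?size_poly0.
Qed.

Lemma mxdeg_tperm_conj n i j A :
  (mxdeg A <= n)%N -> (mxdeg (tperm_mx i j *m A *m tperm_mx i j) <= n)%N.
Proof.
move=> /mxdeg_leP An; rewrite -xrowE -xcolE.
by apply/mxdeg_leP=> k l; rewrite !mxE.
Qed.

(** The intertwining relation B U = U A is easier to compute with than
B = U A U^-1, as it involves no inverse. *)
Lemma conj_byE U A B : conj_by U A B <-> U \in unitmx /\ B *m U = U *m A.
Proof.
split=> [[Uu ->]|[Uu eqBU]]; split=> //; first by rewrite mulmxKV.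
by rewrite -eqBU mulmxK.
Qed.

Lemma conj_by_comp U V A B C :
  conj_by U A B -> conj_by V B C -> conj_by (V *m U) A C.
Proof.
move=> /conj_byE[Uu eqBU] /conj_byE[Vu eqCV]; apply/conj_byE.
by rewrite unitmx_mul Uu Vu mulmxA eqCV -mulmxA eqBU mulmxA.
Qed.

Lemma unitmx_mx2E (a b c d : {poly F}) :
  (mx2 a b c d \in unitmx) = (size (a * d - b * c)%R == 1%N).
Proof.
rewrite unitmxE det_mx2 poly_unitE; apply: andb_idr => /size_poly1P[e e0 ->].
by rewrite coefC unitfE.
Qed.

End Degree.

(** * Convexity of the degree *)

Section Convexity.

Variable F : fieldType.
Implicit Types (w x y : {poly F}) (A B : 'M[{poly F}]_2).

(** This is det (x A, y), the determinant of the matrix with rows x A and y. *)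
Definition form A x1 x2 y1 y2 : {poly F} :=
  (x1 * A 0 0 + x2 * A 1 0) * y2 - (x1 * A 0 1 + x2 * A 1 1) * y1.

(** Since U^-1 is the adjugate of U up to the determinant D, the entries of
D * (U A U^-1) are values of [form A] on pairs of rows of U. *)
Lemma intertwine_form A B u1 u2 v1 v2 :
  let D := u1 * v2 - u2 * v1 in
  B *m mx2 u1 u2 v1 v2 = mx2 u1 u2 v1 v2 *m A ->
  [/\ D * B 0 0 = form A u1 u2 v1 v2, D * B 0 1 = - form A u1 u2 u1 u2,
      D * B 1 0 = form A v1 v2 v1 v2 & D * B 1 1 = - form A v1 v2 u1 u2].
Proof.
rewrite /form [B]mx2_eta [A]mx2_eta !mul_mx2 !mxE /= => /mx2_inj[e1 e2 e3 e4].
by split; rewrite -?e1 -?e2 -?e3 -?e4; ring.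
Qed.

(** Take w = (w1, w2) with w1 dominant of degree k.  In the basis w, (0, 1) over
the rational functions, x has coordinates x1 / w1, of degree at most i - k, and
det (w, x) / w1, of degree at most i' - k; likewise for y.  The values of the
form on this basis have degree at most d, k + d, k + d and d, the first one by
hypothesis rather than the expected 2 k + d: this gain is what the numerical
conditions exploit. *)
Lemma form_deg_le d k i i' j j' A w1 w2 x1 x2 y1 y2 :
    size w1 = k.+1 -> deg_le k w2 -> (mxdeg A <= d)%N ->
    deg_le d (form A w1 w2 w1 w2) ->
    deg_le i x1 -> deg_le i' (w1 * x2 - w2 * x1) ->
    deg_le j y1 -> deg_le j' (w1 * y2 - w2 * y1) ->
    (i <= k)%N -> (j <= k)%N -> (i' <= k)%N -> (j' <= k)%N ->
    (i + j' <= k)%N -> (i' + j <= k)%N ->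
  deg_le d (form A x1 x2 y1 y2).
Proof.
move=> szw w2k Ad formd x1i; set m := _ - w2 * x1; move=> mi'.
move=> y1j; set n := _ - w2 * y1; move=> nj' ik jk i'k j'k ij' i'j.
have w1k : deg_le k w1 by rewrite /deg_le szw.
apply: (deg_le_mulI szw); apply: (deg_le_mulI szw).
(* Expand bilinearly w1 * x = x1 * (w1, w2) + m * (0, 1), and likewise y. *)
have -> : w1 * (w1 * form A x1 x2 y1 y2) =
    x1 * y1 * form A w1 w2 w1 w2 + x1 * n * (w1 * A 0 0 + w2 * A 1 0)
    + (m * y1 * (w2 * A 1 0 - w1 * A 1 1)) + m * n * A 1 0.
  by rewrite /form /m /n; ring.
have Ad' := mxdeg_leP _ _ Ad.
repeat apply: deg_leD.
- by apply: (@deg_leW _ (i + j + d)); [lia|do !apply: deg_leM].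
- apply: (@deg_leW _ (i + j' + (k + d))); first lia.
  by apply: deg_leM; [apply: deg_leM|apply: deg_leD; apply: deg_leM].
- apply: (@deg_leW _ (i' + j + (k + d))); first lia.
  by apply: deg_leM; [apply: deg_leM|apply: deg_leB; apply: deg_leM].
- by apply: (@deg_leW _ (i' + j' + d)); [lia|do !apply: deg_leM].
Qed.

(** With k, l the degrees of w and v, the rows (v, v2) and (s, s2) of the new
conjugating matrix have first entries of degree at most l, and determinants
against (w, w2) of degree 0 and k - l, so that [form_deg_le] bounds the first
column of the conjugate.  Its other entries are an entry of B and the trace
minus an entry already bounded. *)
Lemma euclid_step_mxdeg d A B w w2 v v2 :
    (mxdeg A <= d)%N -> (mxdeg B <= d)%N ->
    mx2 w w2 v v2 \in unitmx -> B *m mx2 w w2 v v2 = mx2 w w2 v v2 *m A ->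
    (size w2 <= size w)%N -> (size v <= size w)%N -> v != 0 ->
  (mxdeg (mx2 0 1 1 (- (w %/ v)) *m B *m mx2 (w %/ v) 1 1 0) <= d)%N.
Proof.
move=> Ad Bd; rewrite unitmx_mx2E => /eqP szD eqBU w2w vw v0.
set p := w %/ v; set s := w - p * v; pose s2 := w2 - p * v2.
set C := _ *m mx2 p 1 1 0.
have eqs : s = w %% v by rewrite /s [in LHS](divp_eq w v) addrC addKr.
have szv : (0 < size v)%N by rewrite size_poly_gt0.
have [l szvl] : exists l, size v = l.+1 by exists (size v).-1; rewrite prednK.
have [k szw] : exists k, size w = k.+1 by exists (size w).-1; lia.
have lk : (l <= k)%N by lia.
have eqCU : C *m mx2 v v2 s s2 = mx2 v v2 s s2 *m A.
  exact: euclid_step_intertwine.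
have [_ fB _ _] := intertwine_form eqBU; have Dd := mxdeg_leP _ _ Bd.
have D0 : deg_le 0 (w * v2 - w2 * v) by rewrite /deg_le szD.
have form_d : deg_le d (form A w w2 w w2).
  by rewrite -deg_leN -fB -[d]add0n deg_leM.
have sl : deg_le l s by rewrite /deg_le eqs -szvl ltnW // ltn_modp.
have vl : deg_le l v by rewrite /deg_le szvl.
have pkl : deg_le (k - l) (w * s2 - w2 * s).
  have -> : w * s2 - w2 * s = - p * (w * v2 - w2 * v) by rewrite /s /s2; ring.
  rewrite -[(k - l)%N]addn0 deg_leM // deg_leN /deg_le size_divp //.
  by rewrite szw szvl; lia.
have szD' : size (v * s2 - v2 * s)%R = 1%N.
  have -> : v * s2 - v2 * s = - (w * v2 - w2 * v) by rewrite /s /s2; ring.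
  by rewrite size_polyN.
have [eq00 _ eq10 _] := intertwine_form eqCU.
have w2k : deg_le k w2 by rewrite /deg_le -szw.
have C00 : deg_le d (C 0 0).
  apply: (deg_le_mulI szD'); rewrite add0n eq00.
  by apply: (form_deg_le szw w2k Ad form_d vl D0 sl pkl); lia.
have C10 : deg_le d (C 1 0).
  apply: (deg_le_mulI szD'); rewrite add0n eq10.
  by apply: (form_deg_le szw w2k Ad form_d sl pkl sl pkl); lia.
move: C00 C10; rewrite /C [B]mx2_eta !mul_mx2 !mxE /= => C00 C10.
apply/mxdeg_mx2P; split=> //.
  by rewrite !(mul0r, mul1r, mulr0, mulr1, add0r, addr0).
have -> : (1 * B 0 0 + - p * B 1 0) * 1 + (1 * B 0 1 + - p * B 1 1) * 0
  = B 0 0 + B 1 1 - ((0 * B 0 0 + 1 * B 1 0) * p + (0 * B 0 1 + 1 * B 1 1) * 1).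
  by ring.
by apply: deg_leB => //; apply: deg_leD.
Qed.

End Convexity.

(** * Short conjugations *)

Section Walks.

Variables (F : finFieldType) (d : nat).
Implicit Types A B U E : 'M[{poly F}]_2.

(** Square matrices of polynomials of degree at most d, encoded by coefficient
vectors so as to form a finite type. *)
Definition bmx := 'M['rV[F]_d.+1]_2.

Definition bmx_val (X : bmx) : 'M[{poly F}]_2 := map_mx rVpoly X.

Definition to_bmx A : bmx := map_mx poly_rV A.

Lemma mxdeg_bmx_val X : (mxdeg (bmx_val X) <= d)%N.
Proof. by apply/mxdeg_leP=> i j; rewrite mxE /deg_le size_poly. Qed.

Lemma to_bmxK A : (mxdeg A <= d)%N -> bmx_val (to_bmx A) = A.
Proof.
by move=> /mxdeg_leP Ad; apply/matrixP=> i j; rewrite !mxE poly_rV_K //; apply: Ad.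
Qed.

Lemma card_bmx : #|{: bmx}| = (#|F| ^ (4 * d.+1))%N.
Proof. by rewrite card_mx card_mx -expnM mul1n mulnC. Qed.

Definition short_conj : rel bmx := fun X Y =>
  [exists E : bmx, (bmx_val E \in unitmx)
                   && (bmx_val Y *m bmx_val E == bmx_val E *m bmx_val X)].

Definition linked A B := connect short_conj (to_bmx A) (to_bmx B).

Lemma linked_trans A B C : linked A B -> linked B C -> linked A C.
Proof. exact: connect_trans. Qed.

Lemma short_conj_linked E A B :
    (mxdeg E <= d)%N -> (mxdeg A <= d)%N -> (mxdeg B <= d)%N ->
    E \in unitmx -> B *m E = E *m A ->
  linked A B.
Proof.
move=> Ed Ad Bd Eu eqBE; apply: connect1; apply/existsP; exists (to_bmx E).
by rewrite !to_bmxK // Eu eqBE /=.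
Qed.

(** A path without repetition visits each matrix of degree at most d at most
once, and each of its edges adds at most d to the degree of the product. *)
Lemma linked_bounded A B :
    (mxdeg A <= d)%N -> (mxdeg B <= d)%N -> linked A B ->
  exists2 U, conj_by U A B & (mxdeg U <= d * #|F| ^ (4 * d.+1))%N.
Proof.
move=> Ad Bd /connectP[s0 path_s0 last_s0].
rewrite -(to_bmxK Ad) -(to_bmxK Bd) {}last_s0 -card_bmx.
case: (shortenP path_s0) => s path_s uniq_s _.
have {uniq_s} lt_s : (size s <= #|{: bmx}|)%N.
  by have /card_uniqP := uniq_s; rewrite /= => /(congr1 predn) /= <-;
    apply: leq_trans (leq_pred _) (max_card _).
suff [U AU Us] : exists2 U, conj_by U (bmx_val (to_bmx A))
    (bmx_val (last (to_bmx A) s)) & (mxdeg U <= d * size s)%N.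
  by exists U => //; apply: leq_trans Us _; rewrite leq_mul2l lt_s orbT.
elim: s (to_bmx A) path_s {lt_s} => [|Y s IHs] X /=.
  move=> _; exists 1%:M; first by apply/conj_byE; rewrite unitmx1 mulmx1 mul1mx.
  by apply/mxdeg_leP=> i j; rewrite mxE /deg_le;
    case: eqP; rewrite ?size_poly1 ?size_poly0.
case/andP=> /existsP[E /andP[Eu /eqP eqYE]] /IHs[U YU Us].
exists (U *m bmx_val E); first by apply: conj_by_comp YU; apply/conj_byE.
by rewrite (leq_trans (mxdeg_mul _ _)) // addnC mulnS leq_add ?mxdeg_bmx_val.
Qed.

(** For deg p > d the entries of B E_p = E_p A give two multiples of p of degree
at most d, which must vanish: A 0 0 = B 0 0, then A 0 1 = 0 and
A 0 0 = A 1 1.  In that case p acts trivially, and it may be replaced by 0. *)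
Lemma euclid_step_linked A B p :
    (mxdeg A <= d)%N -> (mxdeg B <= d)%N ->
    B *m mx2 p 1 1 0 = mx2 p 1 1 0 *m A ->
  linked A B.
Proof.
move=> Ad Bd; case: (leqP (size p) d.+1) => [p_d|d_p] eqBE.
  apply: short_conj_linked eqBE => //; last first.
    by rewrite unitmx_mx2E mulr0 mul1r sub0r size_polyN size_poly1.
  by apply/mxdeg_mx2P; rewrite /deg_le size_poly1 size_poly0.
have swapu : mx2 (0 : {poly F}) 1 1 0 \in unitmx.
  by rewrite unitmx_mx2E mulr0 mul1r sub0r size_polyN size_poly1.
apply: short_conj_linked (swapu) _ => //.
  by apply/mxdeg_mx2P; rewrite /deg_le size_poly1 size_poly0.
have [Aij Bij] := (mxdeg_leP _ _ Ad, mxdeg_leP _ _ Bd).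
move: eqBE; rewrite [A]mx2_eta [B]mx2_eta !mul_mx2.
rewrite !(mul0r, mul1r, mulr0, mulr1, add0r, addr0).
move=> /mx2_inj[e00 B00 e10 B10].
have {e00} B01 := canRL (addKr _) e00.
have a_B00 : A 0 0 - B 0 0 = 0.
  apply: deg_le_mul0 d_p _.
  have -> : p * (A 0 0 - B 0 0) = B 0 1 - A 1 0 by rewrite B01; ring.
  exact: deg_leB.
have b0 : A 0 1 = 0.
  apply: deg_le_mul0 d_p _.
  have -> : p * A 0 1 = A 0 0 - A 1 1 by rewrite (subr0_eq a_B00) B00; ring.
  exact: deg_leB.
have e10' : B 1 1 = A 0 0 by rewrite -e10 B10 b0; ring.
congr mx2 => //; last by rewrite B00 b0; ring.
by rewrite B01 (subr0_eq a_B00); ring.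
Qed.

(** Euclidean algorithm on the first column (w, v).  The two size conditions,
that w dominates its row and its column, are what convexity requires; both
pass to the next step. *)
Lemma euclid_linked A B w w2 v v2 :
    (mxdeg A <= d)%N -> (mxdeg B <= d)%N ->
    mx2 w w2 v v2 \in unitmx -> B *m mx2 w w2 v v2 = mx2 w w2 v v2 *m A ->
    (size w2 <= size w)%N -> (size v <= size w)%N ->
  linked A B.
Proof.
move=> Ad; have [n] := ubnP (size v).
elim: n => // n IHn in B w w2 v v2 *; rewrite ltnS => vn Bd Uu eqBU w2w vw.
have [v0|v0] := eqVneq v 0.
  move: Uu eqBU w2w; rewrite {}v0 => Uu eqBU w2w.
  have /eqP : size (w * v2) == 1 by move: Uu; rewrite unitmx_mx2E mulr0 subr0.
  move=> /eqP; rewrite size_mul_eq1 => /andP[/eqP w1 /eqP v21].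
  apply: short_conj_linked eqBU => //; apply/mxdeg_mx2P.
  by rewrite /deg_le w1 v21 size_poly0 (leq_trans w2w) ?w1.
have Cd := euclid_step_mxdeg Ad Bd Uu eqBU w2w vw v0.
set p := w %/ v in Cd; set C := _ *m _ in Cd.
have eqBE : B *m mx2 p 1 1 0 = mx2 p 1 1 0 *m C.
  by rewrite /C !mulmxA quotient_mx2K mul1mx.
apply: linked_trans (euclid_step_linked Cd Bd eqBE).
have szD : size (w * v2 - w2 * v) = 1%N by apply/eqP; rewrite -unitmx_mx2E.
have eqs : w - p * v = w %% v by rewrite [in LHS](divp_eq w v) addrC addKr.
have sv : (size (w - p * v)%R < size v)%N by rewrite eqs ltn_modp.
apply: (IHn C v v2 (w - p * v) (w2 - p * v2)) => //; last exact: ltnW.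
- exact: leq_trans sv vn.
- rewrite unitmx_mx2E -size_polyN -szD; apply/eqP; congr (size (polyseq _)); ring.
- exact: euclid_step_intertwine.
- have w0 : w != 0 by rewrite -size_poly_gt0 (leq_trans _ vw) ?size_poly_gt0.
  exact: size_unimodular_row2 szD w2w w0 v0.
Qed.

(** Exchanges of rows and of columns bring an entry of maximal degree of U to the
top left corner; on A and B they act as conjugations by constant matrices. *)
Lemma conj_linked A B U :
    (mxdeg A <= d)%N -> (mxdeg B <= d)%N ->
    U \in unitmx -> B *m U = U *m A ->
  linked A B.
Proof.
move=> Ad Bd Uu eqBU.
have [ij _ Umax] := @arg_maxnP _ (0, 0) xpredT
  (fun k : 'I_2 * 'I_2 => size (U k.1 k.2)) isT.
move: ij Umax => [i j] /= Umax.
pose P := tperm_mx 0 i : 'M[{poly F}]_2; pose Q := tperm_mx 0 j : 'M[{poly F}]_2.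
have Pu : P \in unitmx := unitmx_perm _ _.
have Qu : Q \in unitmx := unitmx_perm _ _.
have PP : P *m P = 1%:M by rewrite -perm_mxM tperm2 perm_mx1.
have QQ : Q *m Q = 1%:M by rewrite -perm_mxM tperm2 perm_mx1.
have PBd : (mxdeg (P *m B *m P) <= d)%N := mxdeg_tperm_conj _ _ Bd.
have QAd : (mxdeg (Q *m A *m Q) <= d)%N := mxdeg_tperm_conj _ _ Ad.
have AQA : linked A (Q *m A *m Q).
  apply: (@short_conj_linked Q) => //; first exact: mxdeg_tperm.
  by rewrite -mulmxA QQ mulmx1.
have PBB : linked (P *m B *m P) B.
  apply: (@short_conj_linked P) => //; first exact: mxdeg_tperm.
  by rewrite !mulmxA PP mul1mx.
apply: linked_trans AQA _; apply: linked_trans PBB.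
have eqU' : P *m B *m P *m (P *m U *m Q) = P *m U *m Q *m (Q *m A *m Q).
  rewrite -!mulmxA (mulmxA P P) PP mul1mx (mulmxA Q Q) QQ mul1mx.
  by rewrite (mulmxA B) eqBU !mulmxA.
have U'u : P *m U *m Q \in unitmx by rewrite !unitmx_mul Pu Uu Qu.
have U'max a b : (size ((P *m U *m Q) a b) <= size ((P *m U *m Q) 0%R 0%R))%N.
  rewrite -xrowE -xcolE !mxE !tpermL.
  exact: (Umax (_, _)).
rewrite [P *m U *m Q]mx2_eta in U'u eqU'.
by apply: euclid_linked U'u eqU' _ _.
Qed.

End Walks.

Theorem theorem1p1 (F : finFieldType) (A B : 'M[{poly F}]_2) :
  let q := #|F| in
  let delta := maxn (mxdeg A) (mxdeg B) in
  conjugate A B ->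
  exists U : 'M[{poly F}]_2,
    conj_by U A B /\ (mxdeg U <= (1 + q) * delta * q ^ (7 * delta))%N.
Proof.
move=> q d [U /conj_byE[Uu eqBU]].
have Ad : (mxdeg A <= d)%N by rewrite leq_maxl.
have Bd : (mxdeg B <= d)%N by rewrite leq_maxr.
have [V AV Vd] := linked_bounded Ad Bd (conj_linked Ad Bd Uu eqBU).
exists V; split=> //; apply: leq_trans Vd _.
have q_gt0 : (0 < q)%N by apply/card_gt0P; exists 0.
case: d {Ad Bd} => [|d]; first by rewrite mul0n.
rewrite [((1 + q) * _)%N]mulnC -mulnA leq_mul2l /=.
apply: (@leq_trans (q ^ (7 * d.+1).+1)); first by rewrite leq_pexp2l //; lia.
by rewrite expnS leq_mul2r leq_addl orbT.
Qed.
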